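(* Let $n\ge1$, $\beta>0$, $a,b>-1$, let $(x_1,\dots,x_n)$ have the Jacobi distribution $$\mathrm{cst}\,|\Delta(x_1,\dots,x_n)|^\beta\prod_{j=1}^n(2-x_j)^a(2+x_j)^b\,dx_1\cdots dx_n$$ on $(-2,2)^n$, and let $\det^{(+)}=\prod_{k=1}^n(2-x_k)$. Then $\det^{(+)}$ has a density $h_n$ on $(0,\infty)$ such that, for some constant $c(n)>0$ (depending on $n,\beta,a,b$), $$h_n(\varepsilon)\ \sim\ c(n)\,\varepsilon^a\qquad\text{as }\varepsilon\to0^+.$$
   Context: $\Delta(x_1,\dots,x_n)=\prod_{1\le k<l\le n}(x_l-x_k)$ is the Vandermonde determinant and $\mathrm{cst}$ is the normalization constant making the expression a probability measure. *)

(* Defs.v *)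
From HB Require Import structures.
From mathcomp Require Import all_boot all_order all_algebra.
From mathcomp Require Import all_classical all_reals all_analysis.
Set Implicit Arguments.
Unset Strict Implicit.
Unset Printing Implicit Defensive.
Import Order.TTheory GRing.Theory Num.Theory.
Import numFieldNormedType.Exports.
Local Open Scope classical_set_scope.
Local Open Scope ring_scope.

Section lebesgue_cons.
Local Open Scope ereal_scope.
Context {R : realType} (n : nat).

Definition tuple_of_pair (p : R * n.-tuple R) : n.+1.-tuple R :=
  [tuple of p.1 :: p.2].

Let pair_of_tuple (t : n.+1.-tuple R) : R * n.-tuple R :=
  (thead t, [tuple of behead t]).

Let tuple_of_pairK : cancel tuple_of_pair pair_of_tuple.
Proof. by move=> [x t]; congr pair; exact: val_inj. Qed.

Lemma measurable_tuple_of_pair : measurable_fun setT tuple_of_pair.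
Proof. exact: (measurable_cons measurable_fst measurable_snd). Qed.

Let measurable_pair_of_tuple : measurable_fun setT pair_of_tuple.
Proof.
by apply: measurable_fun_pair; [exact: measurable_tnth|exact: measurable_behead].
Qed.

Variable m : {sigma_finite_measure set (n.-tuple R) -> \bar R}.

Definition lebesgue_cons : set (n.+1.-tuple R) -> \bar R :=
  pushforward ((@lebesgue_measure R) \x m) tuple_of_pair.

Let lebesgue_cons0 : lebesgue_cons set0 = 0.
Proof. exact: (measure0 (@lebesgue_measure R \x m)). Qed.

Let lebesgue_cons_ge0 A : 0 <= lebesgue_cons A.
Proof. exact: (measure_ge0 (@lebesgue_measure R \x m)). Qed.

Let mpre A : measurable A -> measurable (tuple_of_pair @^-1` A).
Proof.
by move=> mA; rewrite -[X in measurable X]setTI; exact: measurable_tuple_of_pair.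
Qed.

Let lebesgue_cons_semi_sigma_additive : semi_sigma_additive lebesgue_cons.
Proof.
move=> F mF tF mUF; rewrite /lebesgue_cons /pushforward preimage_bigcup.
apply: measure_semi_sigma_additive.
- by move=> k; exact: mpre.
- apply/trivIsetP => /= i j _ _ ij; rewrite -preimage_setI.
  by move/trivIsetP : tF => /(_ _ _ _ _ ij) ->//; rewrite preimage_set0.
- by rewrite -preimage_bigcup; exact: mpre.
Qed.

HB.instance Definition _ := isMeasure.Build _ _ _ lebesgue_cons
  lebesgue_cons0 lebesgue_cons_ge0 lebesgue_cons_semi_sigma_additive.

Let lebesgue_cons_sigma_finite : sigma_finite setT lebesgue_cons.
Proof.
have /sigma_finiteP[F [FT ndF Ffin]] := sigma_finiteT (@lebesgue_measure R).
have /sigma_finiteP[G [GT ndG Gfin]] := sigma_finiteT m.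
exists (fun k => pair_of_tuple @^-1` (F k `*` G k)).
  rewrite -preimage_bigcup (_ : \bigcup_k _ = setT) ?preimage_setT//.
  apply/seteqP; split=> // -[x y] _.
  have [i _ Fi] : (\bigcup_i F i) x by rewrite -FT.
  have [j _ Gj] : (\bigcup_j G j) y by rewrite -GT.
  exists (maxn i j) => //; split.
  - by move: x Fi; exact/subsetPset/ndF/leq_maxl.
  - by move: y Gj; exact/subsetPset/ndG/leq_maxr.
move=> k; have [mFk Fk] := Ffin k; have [mGk Gk] := Gfin k; split.
  rewrite -[X in measurable X]setTI; apply: measurable_pair_of_tuple => //.
  exact: measurableX.
rewrite /lebesgue_cons /pushforward -comp_preimage (_ : _ \o _ = id).
  by rewrite preimage_id product_measure1E// lte_mul_pinfty// ge0_fin_numE.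
by apply/funext => x; exact: tuple_of_pairK.
Qed.

HB.instance Definition _ := Measure_isSigmaFinite.Build _ _ _ lebesgue_cons
  lebesgue_cons_sigma_finite.

End lebesgue_cons.

(* n-dimensional Lebesgue measure on the product sigma-algebra of R^n; see
   [lebesgue_tuple_box]. *)
Fixpoint lebesgue_tuple {R : realType} (n : nat) :
    {sigma_finite_measure set (n.-tuple R) -> \bar R} :=
  match n with
  | 0 => \d_([tuple] : 0.-tuple R)
  | m.+1 => lebesgue_cons (lebesgue_tuple m)
  end.

Lemma measurable_box {R : realType} n (A : 'I_n -> set R) :
  (forall i, measurable (A i)) ->
  measurable [set x : n.-tuple R | forall i, A i (tnth x i)].
Proof.
move=> mA.
rewrite (_ : [set x | _] =
    \bigcap_(i in setT) ((fun x : n.-tuple R => tnth x i) @^-1` A i)).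
  apply: fin_bigcap_measurable => // i _.
  by rewrite -[X in measurable X]setTI; exact: (measurable_tnth i).
by apply/seteqP; split=> [x h i _|x h i]; [exact: h|exact: (h i I)].
Qed.

Lemma lebesgue_tuple_box {R : realType} n (A : 'I_n -> set R) :
  (forall i, measurable (A i)) ->
  lebesgue_tuple n [set x | forall i, A i (tnth x i)] =
  (\prod_(i < n) @lebesgue_measure R (A i))%E.
Proof.
elim: n A => [|n IHn] A mA.
  by rewrite big_ord0 /= diracE mem_set// => -[].
rewrite big_ord_recl -IHn//= /lebesgue_cons /pushforward.
rewrite (_ : _ @^-1` _ =
    A ord0 `*` [set x | forall i, A (lift ord0 i) (tnth x i)]).
  rewrite product_measure1E//; [exact: mA|].
  by apply: (@measurable_box _ _ (A \o lift ord0)) => i; exact: mA.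
apply/seteqP; split=> [[x t] /= h|[x t] /= [h0 h] i].
  by split=> [|i]; [have := h ord0|have := h (lift ord0 i); rewrite tnthS].
by have [j ->|->] := unliftP ord0 i; [rewrite tnthS; exact: h|exact: h0].
Qed.

Section jacobi.
Context {R : realType} (n : nat).
Implicit Types x : n.-tuple R.

Definition vandermonde x : R :=
  \prod_(k < n) \prod_(l < n | (k < l)%N) (tnth x l - tnth x k).

Definition jacobi_weight (beta a b : R) x : R :=
  `|vandermonde x| `^ beta *
  \prod_(j < n) ((2 - tnth x j) `^ a * (2 + tnth x j) `^ b).

Definition jacobi_cube : set (n.-tuple R) :=
  [set x | forall j, tnth x j \in `]-2, 2[].

(* Inverse of the normalization constant; it lies in (0, +oo) when beta > 0 and
   a, b > -1, so that [fine] below loses nothing. *)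
Definition jacobi_mass (beta a b : R) : \bar R :=
  (\int[lebesgue_tuple n]_(x in jacobi_cube) (jacobi_weight beta a b x)%:E)%E.

Definition jacobi_law (beta a b : R) (A : set (n.-tuple R)) : \bar R :=
  (((fine (jacobi_mass beta a b))^-1)%:E *
   \int[lebesgue_tuple n]_(x in A `&` jacobi_cube)
      (jacobi_weight beta a b x)%:E)%E.

Definition det_plus x : R := \prod_(k < n) (2 - tnth x k).

End jacobi.
Arguments jacobi_law {R} n beta a b A.
Arguments jacobi_mass {R} n beta a b.

Definition jacobi_distributed {R : realType} (n : nat) (beta a b : R)
    (d : measure_display) (Omega : measurableType d) (P : probability Omega R)
    (X : {RV P >-> n.-tuple R}) : Prop :=
  forall A, measurable A -> distribution P X A = jacobi_law n beta a b A.

(* B ranges over all Borel sets of R, so this includes mu ]-oo, 0] = 0. *)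
Definition is_density_pos {R : realType} (mu : set R -> \bar R) (h : R -> R) :
    Prop :=
  [/\ measurable_fun (`]0, +oo[ : set R) h,
      forall e, 0 < e -> 0 <= h e &
      forall B, measurable B ->
        mu B =
        (\int[lebesgue_measure]_(e in B `&` [set` `]0%R, +oo[%R]) (h e)%:E)%E].

(* Main.v *)
(* The density vanishes where two coordinates coincide, so exactly one coordinate
   is the largest; by symmetry the law of det is n = m + 1 times its restriction
   to the region where the first coordinate x is the largest. Write t for the other
   m coordinates and p for the product of the [2 - t_j]. Substituting
   x = 2 - e / p and applying Tonelli's theorem gives the density of det at e:
   it is a constant times e^a times the integral over t of
     |Delta(t)|^beta (2 + x)^b / p prod_j |t_j - x|^beta (2 + t_j)^b.
   On that region |t_j - x| <= 2 - t_j, and 1 <= x < 2 as soon as e < 1, so the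
   integrand is dominated by a multiple of the Jacobi weight with parameters
   (beta, beta - 1, b) in dimension m, which is integrable since beta > 0. By
   dominated convergence the integral tends to 4^b times the mass of that
   weight. Without the restriction to the largest coordinate this domination
   fails, as e / p does not tend to 0 uniformly in t. *)
Require Import Defs.
From mathcomp Require Import all_boot all_order all_fingroup all_algebra.
From mathcomp Require Import ring lra.
From mathcomp Require Import all_classical all_reals all_analysis.
From mathcomp Require Import measurable_realfun.
Set Implicit Arguments.
Unset Strict Implicit.
Unset Printing Implicit Defensive.
Import Order.TTheory GRing.Theory Num.Theory.
Import numFieldNormedType.Exports.
Local Open Scope classical_set_scope.
Local Open Scope ring_scope.

(* Canonical structure inference cannot supply the measurability proof [mf]. *)
Definition pushforward_measure (d1 d2 : measure_display)
    (T1 : measurableType d1) (T2 : measurableType d2) (R : realFieldType)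
    (m : {measure set T1 -> \bar R}) (f : T1 -> T2)
    (mf : measurable_fun [set: T1] f) : {measure set T2 -> \bar R} :=
  measure_function_pushforward__canonical__measure_function_Measure m mf.

(** * Affine change of variables on the real line *)

Lemma measurable_affine (R : realType) (c d : R) :
  measurable_fun [set: R] (fun y : R => d + c * y : measurableTypeR R).
Proof. by apply: measurable_funD => //; exact: measurable_funM. Qed.

(** Lebesgue measure is determined by its values on the intervals []u, v]], and there [|c|] times
    the pushforward has the same values. For negative [c] the preimage is half-open on the other
    side, whence the two cases. *)
Lemma lebesgue_measure_affine (R : realType) (c d : R) (A : set R) :
  c != 0 -> measurable A ->
  lebesgue_measure A =
  (`|c|%:E * lebesgue_measure ((fun y : R => d + c * y)%R @^-1` A))%E.
Proof.
move=> c0 mA.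
pose phi := fun y : R => d + c * y : measurableTypeR R.
pose nu : {measure set (measurableTypeR R) -> \bar R} :=
  pushforward_measure lebesgue_measure (measurable_affine c d).
have c_ge0 : 0 <= `|c| by [].
pose mu := mscale (NngNum c_ge0) nu.
rewrite (@lebesgue_measure_unique R mu)// => _ [[u v] _] <-.
rewrite -[RHS]/(`|c|%:E * lebesgue_measure (phi @^-1` `]u, v]))%E.
rewrite -[X in lebesgue_measure X = _]/`]u, v]%classic.
rewrite [LHS]lebesgue_measure_itv [LHS]/= lte_fin.
case: (ltrgtP c 0) c0 => // c0 _.
  rewrite (_ : _ @^-1` _ = `[(v - d) / c, (u - d) / c[%classic); last first.
    apply/seteqP; split => y; rewrite /phi /= !in_itv/=;
    rewrite ler_ndivrMr// ltr_ndivlMr//; lra.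
  rewrite lebesgue_measure_itv/= lte_fin ltr_ndivlMr// divfK ?lt_eqF//.
  rewrite ltrD2r; case: ifPn => _; last by rewrite mule0.
  rewrite -!EFinD -EFinM ltr0_norm//; congr EFin; field.
  by rewrite lt_eqF.
rewrite (_ : _ @^-1` _ = `](u - d) / c, (v - d) / c]%classic); last first.
  apply/seteqP; split => y; rewrite /phi /= !in_itv/=;
  rewrite ler_pdivlMr// ltr_pdivrMr//; lra.
rewrite lebesgue_measure_itv/= lte_fin ltr_pdivlMr// divfK ?gt_eqF//.
rewrite ltrD2r; case: ifPn => _; last by rewrite mule0.
rewrite -!EFinD -EFinM gtr0_norm//; congr EFin; field.
by rewrite gt_eqF.
Qed.

Lemma ge0_integral_affine (R : realType) (c d : R) (f : R -> \bar R) :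
  c != 0 -> measurable_fun [set: R] f -> (forall x, (0 <= f x)%E) ->
  (\int[lebesgue_measure]_x f x =
   `|c|%:E * \int[lebesgue_measure]_y f (d + c * y)%R)%E.
Proof.
move=> c0 mf f0.
pose phi := fun y : R => d + c * y : measurableTypeR R.
pose nu : {measure set (measurableTypeR R) -> \bar R} :=
  pushforward_measure lebesgue_measure (measurable_affine c d).
have c_ge0 : 0 <= `|c| by [].
transitivity (\int[mscale (NngNum c_ge0) nu]_x f x)%E.
  apply: eq_measure_integral => A mA _.
  exact: (lebesgue_measure_affine d c0 mA).
rewrite ge0_integral_mscale//= ge0_integral_pushforward//.
exact: measurable_affine.
Qed.

(** * Lebesgue measure on tuples *)

Section lebesgue_tuple.
Context {R : realType}.

Definition perm_tuple n (s : 'S_n) (t : n.-tuple R) : n.-tuple R :=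
  [tuple tnth t (s i) | i < n].

Lemma measurable_perm_tuple n (s : 'S_n) :
  measurable_fun [set: n.-tuple R] (perm_tuple s).
Proof.
apply/measurable_fun_tnthP => i.
rewrite (_ : _ \o _ = fun t : n.-tuple R => tnth t (s i)).
  exact: measurable_tnth.
by apply/funext => t /=; rewrite tnth_mktuple.
Qed.

Definition box n (A : 'I_n -> set R) : set (n.-tuple R) :=
  [set x | forall i, A i (tnth x i)].

Definition boxes n : set (set (n.-tuple R)) :=
  [set B | exists2 A : 'I_n -> set R, (forall i, measurable (A i)) & B = box A].

(** The sigma-algebra on tuples is generated by preimages under one coordinate, and such a preimage
    is a box whose other sides are the whole line. Unlike these preimages, boxes are closed under
    intersection, which uniqueness of measures requires. *)
Lemma measurable_tupleE n : measurable = <<s @boxes n >>.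
Proof.
apply/seteqP; split; last first.
  apply: smallest_sub; first exact: sigma_algebra_measurable.
  by move=> _ [A mA ->]; exact: measurable_box.
apply: smallest_sub; first exact: smallest_sigma_algebra.
case: n => [|n]; first by rewrite big_ord0.
rewrite -bigcup_mkord_ord; apply: bigcup_sub => i _ _ [B mB <-].
apply: sub_sigma_algebra.
exists (fun j => if j == inord i then B else setT) => [j|].
  by case: ifP.
rewrite setTI; apply/seteqP; split => x /=.
  by move=> Bx j; case: eqP => // ->.
by move=> /(_ (inord i)); rewrite eqxx.
Qed.

Lemma boxes_setI n : setI_closed (@boxes n).
Proof.
move=> _ _ [A mA ->] [B mB ->]; exists (fun i => A i `&` B i).
  by move=> i; exact: measurableI.
apply/seteqP; split => x /=; first by move=> [Ax Bx] i; split.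
by move=> ABx; split => i; have [] := ABx i.
Qed.

(** By uniqueness of measures it suffices to compare the two on boxes: permuting the sides of a box
    reorders a product of lengths. The cubes give an exhaustion by sets of finite measure. *)
Lemma lebesgue_tuple_perm n (s : 'S_n) (A : set (n.-tuple R)) : measurable A ->
  lebesgue_tuple n (perm_tuple s @^-1` A) = lebesgue_tuple n A.
Proof.
move=> mA.
pose cube k : set (n.-tuple R) := box (fun=> `](- k%:R), k%:R[%classic).
apply/esym; apply: (measure_unique (@boxes n) cube
    (@measurable_tupleE n) (@boxes_setI n) _ _ _
    (pushforward_measure (lebesgue_tuple n) (measurable_perm_tuple s))) => //.
- by move=> k; exists (fun=> `](- k%:R), k%:R[%classic).
- apply/seteqP; split => // x _.
  (* The sum bounds every [|tnth x i|] at once, so one cube contains [x]. *)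
  pose M := \sum_(i < n) `|tnth x i|.
  pose K := (Num.truncn M).+1.
  exists K => //= i; suff : tnth x i \in `](- K%:R), K%:R[ by [].
  rewrite in_itv/= -ltr_norml; apply: le_lt_trans (truncnS_gt _).
  by rewrite /M (bigD1 i)//= lerDl sumr_ge0.
- move=> _ [B mB ->].
  rewrite -[RHS]/(lebesgue_tuple n (perm_tuple s @^-1` box B)).
  have -> : perm_tuple s @^-1` box B = box (fun i => B ((s^-1)%g i)).
    apply/seteqP; split => x /= Bx i.
      by have := Bx ((s^-1)%g i); rewrite tnth_mktuple permKV.
    by rewrite tnth_mktuple; have := Bx (s i); rewrite permK.
  rewrite [RHS]lebesgue_tuple_box// (reindex_inj (@perm_inj _ s))/=.
  rewrite -[LHS]/(lebesgue_tuple n (box B)) [LHS]lebesgue_tuple_box//.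
   by apply: eq_bigr => i _; rewrite permK.
- move=> k; rewrite [ltLHS](_ : _ = lebesgue_tuple n (cube k))//.
  rewrite lebesgue_tuple_box//.
  set p := (\prod_(i < n) _)%E.
  suff /andP[] : (0 <= p < +oo)%E by [].
  apply: (big_ind (fun x : \bar R => 0 <= x < +oo)%E).
  - by rewrite lee01 ltry.
  - move=> x y /andP[x0 xy] /andP[y0 yy]; rewrite mule_ge0//=.
    by rewrite lte_mul_pinfty// ge0_fin_numE.
  - move=> i _; rewrite measure_ge0/= lebesgue_measure_itv/=.
    by case: ifP => _; rewrite ?ltry.
Qed.

Lemma ge0_integral_perm_tuple n (s : 'S_n) (f : n.-tuple R -> \bar R) :
  measurable_fun [set: n.-tuple R] f -> (forall t, (0 <= f t)%E) ->
  (\int[lebesgue_tuple n]_t f (perm_tuple s t) = \int[lebesgue_tuple n]_t f t)%E.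
Proof.
move=> mf f0.
transitivity (\int[pushforward (lebesgue_tuple n) (perm_tuple s)]_t f t)%E.
  rewrite ge0_integral_pushforward//; first exact: measurable_perm_tuple.
apply: (@eq_measure_integral _ _ _ _ _
  (pushforward_measure (lebesgue_tuple n) (measurable_perm_tuple s))) => A mA _.
exact: lebesgue_tuple_perm.
Qed.

Lemma ge0_integral_tupleS n (f : n.+1.-tuple R -> \bar R) :
  measurable_fun [set: n.+1.-tuple R] f -> (forall t, (0 <= f t)%E) ->
  (\int[lebesgue_tuple n.+1]_t f t =
   \int[lebesgue_measure]_x \int[lebesgue_tuple n]_t f [tuple of x :: t])%E.
Proof.
move=> mf f0.
transitivity (\int[pushforward (@lebesgue_measure R \x lebesgue_tuple n)
    (@tuple_of_pair R n)]_t f t)%E; first by [].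
rewrite ge0_integral_pushforward//; last exact: measurable_tuple_of_pair.
rewrite preimage_setT.
apply: (etrans _ (@fubini_tonelli1 _ _ _ _ _ (@lebesgue_measure R)
  (lebesgue_tuple n) (f \o @tuple_of_pair R n) _ _)) => //.
  exact: measurableT_comp (@measurable_tuple_of_pair R n).
by move=> x; exact: f0.
Qed.

(** With the head integrated innermost, the tail is fixed and a substitution in the head alone
    becomes possible. *)
Lemma ge0_integral_tupleSr n (f : n.+1.-tuple R -> \bar R) :
  measurable_fun [set: n.+1.-tuple R] f -> (forall t, (0 <= f t)%E) ->
  (\int[lebesgue_tuple n.+1]_t f t =
   \int[lebesgue_tuple n]_t \int[lebesgue_measure]_x f [tuple of x :: t])%E.
Proof.
move=> mf f0; rewrite ge0_integral_tupleS//.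
apply: (@fubini_tonelli _ _ _ _ _ (@lebesgue_measure R)
  (lebesgue_tuple n) (f \o @tuple_of_pair R n)) => //.
  exact: measurableT_comp (@measurable_tuple_of_pair R n).
by move=> x; exact: f0.
Qed.

End lebesgue_tuple.

(** * Symmetry of the Jacobi weight *)

Section jacobi_weight.
Context {R : realType}.

(** Permuting the columns of the Vandermonde matrix multiplies its determinant by a sign, which the
    absolute value removes. *)
Lemma normr_vandermonde_perm n (s : 'S_n) (x : n.-tuple R) :
  `|vandermonde (perm_tuple s x)| = `|vandermonde x|.
Proof.
have E (t : n.-tuple R) : vandermonde t =
    \det (Vandermonde n (\row_(i < n) tnth t i)).
  rewrite det_Vandermonde; apply: eq_bigr => k _; apply: eq_bigr => l _.
  by rewrite !mxE.
rewrite !E (_ : Vandermonde _ _ = col_perm s (Vandermonde n (\row_i tnth x i))).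
  by rewrite col_permE det_mulmx det_perm normrM normr_sign mulr1.
by apply/matrixP => i j; rewrite !mxE tnth_mktuple.
Qed.

Lemma vandermonde_cons n (x : R) (t : n.-tuple R) :
  vandermonde [tuple of x :: t] =
  (\prod_(l < n) (tnth t l - x)) * vandermonde t.
Proof.
rewrite /vandermonde big_ord_recl; congr (_ * _).
  rewrite big_mkcond big_ord_recl/= mul1r; apply: eq_bigr => l _.
  by rewrite tnthS tnth0.
apply: eq_bigr => k _; rewrite big_mkcond big_ord_recl/= mul1r.
rewrite [RHS]big_mkcond; apply: eq_bigr => l _.
by rewrite !tnthS /bump !leq0n !add1n ltnS.
Qed.

Lemma vandermonde_eq0 n (x : n.-tuple R) :
  (vandermonde x == 0) =
  [exists i, exists j, (i != j) && (tnth x i == tnth x j)].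
Proof.
apply/idP/existsP => [|[i /existsP[j]]].
  rewrite prodf_seq_eq0 => /hasP[k _ /=].
  rewrite prodf_seq_eq0 => /hasP[l _ /= /andP[kl]].
  rewrite subr_eq0 => xlk; exists l; apply/existsP; exists k.
  by rewrite xlk andbT neq_ltn kl orbT.
wlog ij : i j / (i < j)%N => [wl|].
  move=> /andP[ij xij]; have := ij; rewrite neq_ltn => /orP[|] h.
    by apply: (wl i j) => //; rewrite ij.
  by apply: (wl j i) => //; rewrite eq_sym ij eq_sym.
move=> /andP[_ /eqP xij].
by rewrite /vandermonde (bigD1 i)//= (bigD1 j)//= xij subrr !mul0r.
Qed.

(** Extending the weight by zero lets Tonelli's theorem and substitutions run over the whole
    space. *)
Definition jacobi_density n (beta a b : R) (x : n.-tuple R) : R :=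
  jacobi_weight beta a b x * \1_(@jacobi_cube R n) x.

Lemma jacobi_weight_ge0 n (beta a b : R) (x : n.-tuple R) :
  0 <= jacobi_weight beta a b x.
Proof.
rewrite mulr_ge0 ?powR_ge0// prodr_ge0// => j _.
by rewrite mulr_ge0// powR_ge0.
Qed.

Lemma jacobi_density_ge0 n (beta a b : R) (x : n.-tuple R) :
  0 <= jacobi_density beta a b x.
Proof. by rewrite mulr_ge0 ?jacobi_weight_ge0. Qed.

Lemma jacobi_density_perm n (beta a b : R) (s : 'S_n) (x : n.-tuple R) :
  jacobi_density beta a b (perm_tuple s x) = jacobi_density beta a b x.
Proof.
rewrite /jacobi_density /jacobi_weight normr_vandermonde_perm.
congr (_ * _ * _); last first.
  rewrite !indicE.
  suff -> : (perm_tuple s x \in @jacobi_cube R n) =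
    (x \in @jacobi_cube R n) by [].
  apply/idP/idP; rewrite !inE.
    by move=> xs j; have := xs ((s^-1)%g j); rewrite tnth_mktuple permKV.
  by move=> xs j; rewrite tnth_mktuple.
rewrite [RHS](reindex_inj (@perm_inj _ s))/=.
by apply: eq_bigr => j _; rewrite tnth_mktuple.
Qed.

Lemma det_plus_perm n (s : 'S_n) (x : n.-tuple R) :
  det_plus (perm_tuple s x) = det_plus x.
Proof.
rewrite /det_plus [RHS](reindex_inj (@perm_inj _ s))/=.
by apply: eq_bigr => j _; rewrite tnth_mktuple.
Qed.

Lemma measurable_vandermonde n : measurable_fun setT (@vandermonde R n).
Proof.
apply: measurable_prod => k _.
rewrite (_ : (fun x => _) = fun x : n.-tuple R =>
    \prod_(l < n) (if (k < l)%N then tnth x l - tnth x k else 1)).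
  apply: measurable_prod => l _; case: (k < l)%N => //.
  apply: measurable_funB; first exact: (measurable_tnth l).
  exact: (measurable_tnth k).
by apply/funext => x; rewrite big_mkcond.
Qed.

Lemma measurable_jacobi_weight n (beta a b : R) :
  measurable_fun setT (@jacobi_weight R n beta a b).
Proof.
apply: measurable_funM.
  apply: (measurableT_comp (measurable_powR beta)).
  by apply: measurableT_comp => //; exact: measurable_vandermonde.
apply: measurable_prod => j _; apply: measurable_funM;
  apply: (measurableT_comp (measurable_powR _)).
  by apply: measurable_funB => //; exact: (measurable_tnth j).
by apply: measurable_funD => //; exact: (measurable_tnth j).
Qed.

Lemma measurable_jacobi_cube n : measurable (@jacobi_cube R n).
Proof. by apply: (@measurable_box _ _ (fun=> `]-2, 2[%classic)). Qed.

Lemma measurable_jacobi_density n (beta a b : R) :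
  measurable_fun setT (@jacobi_density n beta a b).
Proof.
apply: measurable_funM; first exact: measurable_jacobi_weight.
exact: measurable_indic (@measurable_jacobi_cube n).
Qed.

Lemma measurable_det_plus n : measurable_fun setT (@det_plus R n).
Proof.
apply: measurable_prod => j _.
by apply: measurable_funB => //; exact: (measurable_tnth j).
Qed.

Lemma integral_jacobi_density n (beta a b : R) (A : set (n.-tuple R)) :
  (\int[lebesgue_tuple n]_(x in A `&` @jacobi_cube R n)
     (jacobi_weight beta a b x)%:E =
   \int[lebesgue_tuple n]_x ((jacobi_density beta a b x)%:E * (\1_A x)%:E))%E.
Proof.
rewrite integral_mkcond; apply: eq_integral => x _.
rewrite patchE in_setI /jacobi_density !indicE.
case: (x \in A); case: (x \in @jacobi_cube R n);
  by rewrite ?mulr1 ?mulr0 ?mule1 ?mule0.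
Qed.

(** Strictness makes the regions for distinct [i] disjoint, at the cost of leaving out ties. *)
Definition strict_top n (i : 'I_n) (x : n.-tuple R) : bool :=
  [forall j, (j != i) ==> (tnth x j < tnth x i)].

Lemma strict_top_perm n (i k : 'I_n) (x : n.-tuple R) :
  strict_top k (perm_tuple (tperm k i) x) = strict_top i x.
Proof.
apply/forallP/forallP => h j; apply/implyP => jk.
- have /implyP := h (tperm k i j).
  rewrite !tnth_mktuple tpermL tpermK; apply.
  by apply: contra_neq jk => jk; rewrite -[j](tpermK k i) jk tpermL.
- have /implyP := h (tperm k i j).
  rewrite !tnth_mktuple tpermL; apply.
  by apply: contra_neq jk => jk; rewrite -[j](tpermK k i) jk tpermR.
Qed.

Lemma measurable_strict_top n (i : 'I_n) :
  measurable [set x : n.-tuple R | strict_top i x].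
Proof.
rewrite (_ : [set x | _] = \bigcap_(j in [set j | j != i])
    [set x : n.-tuple R | tnth x j < tnth x i]).
  apply: fin_bigcap_measurable => [|j _]; first exact: finite_finset.
  rewrite -[X in measurable X]setTI.
  have mlt : measurable_fun setT (fun x : n.-tuple R => tnth x j < tnth x i).
    exact: measurable_fun_ltr (measurable_tnth j) (measurable_tnth i).
  exact: (mlt measurableT [set true]).
apply/seteqP; split => x /=.
  by move=> /forallP h j /= ji; have /implyP := h j; apply.
by move=> h; apply/forallP => j; apply/implyP => ji; exact: h.
Qed.

Lemma measurable_strict_top_indic n (i : 'I_n) :
  measurable_fun setT (fun y : n.-tuple R => (strict_top i y)%:R : R).
Proof.
rewrite (_ : (fun y => _) = \1_[set y : n.-tuple R | strict_top i y]).
  exact: measurable_indic (measurable_strict_top i).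
apply/funext => y; rewrite indicE.
suff -> : (y \in [set y | strict_top i y]) = strict_top i y by [].
by apply/idP/idP; rewrite inE.
Qed.

(* Where the maximum is attained twice, the Vandermonde determinant vanishes,
   and with it the density because [beta <> 0]. *)
Lemma jacobi_density_strict_top n (beta a b : R) (x : n.+1.-tuple R) :
  0 < beta ->
  jacobi_density beta a b x =
  \sum_(i < n.+1) jacobi_density beta a b x * (strict_top i x)%:R.
Proof.
move=> beta0; rewrite -mulr_sumr.
have [->|Vx] := eqVneq (jacobi_density beta a b x) 0; first by rewrite mul0r.
rewrite -[LHS]mulr1; congr (_ * _).
have {}Vx : vandermonde x != 0.
  apply: contra_neq Vx => Vx; rewrite /jacobi_density /jacobi_weight Vx normr0.
  by rewrite powR0 ?gt_eqF// !mul0r.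
case: (@arg_maxP _ _ _ ord0 xpredT (fun i => tnth x i)) => // i _ xi.
have lti j : j != i -> tnth x j < tnth x i.
  move=> ji; have /= lexji := xi j isT; rewrite lt_neqAle lexji andbT.
  apply: contra Vx => xji; rewrite vandermonde_eq0.
  by apply/existsP; exists j; apply/existsP; exists i; rewrite ji.
rewrite (bigD1 i)//= big1 ?addr0.
  by rewrite (_ : strict_top i x)//; apply/forallP => j; apply/implyP/lti.
move=> j ji; rewrite (_ : strict_top j x = false)//.
apply/negP => /forallP/(_ i); rewrite eq_sym ji/= ltNge.
by rewrite (ltW (lti _ ji)).
Qed.

(** The integral splits according to which coordinate is the strict maximum, and the transposition
    of [ord0] and [i] identifies the [i]-th piece with the one for [ord0]. *)
Lemma ge0_integral_jacobi_density n (beta a b : R)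
    (g : n.+1.-tuple R -> \bar R) :
  0 < beta -> measurable_fun setT g -> (forall t, (0 <= g t)%E) ->
  (forall s t, g (perm_tuple s t) = g t) ->
  (\int[lebesgue_tuple n.+1]_t ((jacobi_density beta a b t)%:E * g t) =
   n.+1%:R%:E * \int[lebesgue_tuple n.+1]_t
     ((jacobi_density beta a b t * (strict_top ord0 t)%:R)%:E * g t))%E.
Proof.
move=> beta0 mg g0 gs.
pose F i (t : n.+1.-tuple R) :=
  ((jacobi_density beta a b t * (strict_top i t)%:R)%:E * g t)%E.
have F0 i t : (0 <= F i t)%E.
  by rewrite mule_ge0// lee_fin mulr_ge0// jacobi_density_ge0.
have mF i : measurable_fun setT (F i).
  apply: emeasurable_funM => //; apply/measurable_EFinP/measurable_funM.
    exact: measurable_jacobi_density.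
  exact: measurable_strict_top_indic.
transitivity (\int[lebesgue_tuple n.+1]_t (\sum_(i < n.+1) F i t))%E.
  apply: eq_integral => t _; rewrite {1}jacobi_density_strict_top//.
  rewrite -sumEFin ge0_sume_distrl// => i _.
  by rewrite lee_fin mulr_ge0// jacobi_density_ge0.
rewrite ge0_integral_sum// (eq_bigr (fun=> \int[lebesgue_tuple n.+1]_t F ord0 t)%E).
  by rewrite sumr_const card_ord mule_natl.
move=> i _; rewrite -(ge0_integral_perm_tuple (tperm ord0 i))//.
apply: eq_integral => t _.
by rewrite /F jacobi_density_perm strict_top_perm gs.
Qed.

End jacobi_weight.

(** * Integrability of the Jacobi weight *)

Section jacobi_mass.
Context {R : realType}.

(** A power is monotone, in a direction given by the sign of [s]; the sum of both endpoint values
    bounds it in either case. *)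
Lemma powR_le_endpoints (s u v y : R) :
  0 < u -> u <= y <= v -> y `^ s <= u `^ s + v `^ s.
Proof.
move=> u0 /andP[uy yv]; have y0 := lt_le_trans u0 uy.
have v0 := lt_le_trans y0 yv.
have [s0|s0] := leP 0 s.
  apply: (@le_trans _ _ (v `^ s)); last by rewrite lerDr powR_ge0.
  by apply: ge0_ler_powR => //; rewrite nnegrE ltW.
apply: (@le_trans _ _ (u `^ s)); last by rewrite lerDl powR_ge0.
rewrite -[s]opprK !(powRN _ (- s)) lef_pV2 ?posrE ?powR_gt0//.
by apply: ge0_ler_powR => //; rewrite ?nnegrE ?oppr_ge0 ltW.
Qed.

(** The fundamental theorem of calculus applies away from 0. The bound is free of [u], so [u] can
    afterwards tend to 0. *)
Lemma integral_powR_pos (s u v : R) : -1 < s -> 0 < u < v ->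
  (\int[lebesgue_measure]_(y in `[u, v]) (y `^ s)%:E <=
   (v `^ (s + 1) / (s + 1))%:E)%E.
Proof.
move=> s1 /andP[u0 uv].
have s10 : 0 < s + 1 by lra.
have v0 := lt_trans u0 uv.
pose F (y : R) := (s + 1)^-1 * y `^ (s + 1).
have dF (y : R) : 0 < y -> is_derive y 1 F (y `^ s).
  move=> y0; have -> : y `^ s = (s + 1)^-1 *: ((s + 1) * y `^ (s + 1 - 1)).
    by rewrite addrK /GRing.scale/= mulKf// gt_eqF.
  exact: (is_deriveZ _ (is_derive1_powR (s + 1) y0)).
have cF (y : R) : 0 < y -> {for y, continuous F}.
  move=> y0; apply/differentiable_continuous/derivable1_diffP.
  by have [] := dF _ y0.
rewrite (@continuous_FTC2 _ _ F)//.
- rewrite -EFinB lee_fin /F [leRHS]mulrC gerBl.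
  by rewrite mulr_ge0 ?invr_ge0 ?powR_ge0// ltW.
- apply: derivable_within_continuous => y; rewrite in_itv/= => /andP[uy _].
  apply: derivable_powR.
  by rewrite in_itv/= andbT (lt_le_trans u0).
- split.
  + by move=> y; rewrite in_itv/= => /andP[uy _]; have [] := dF y (lt_trans u0 uy).
  + by apply: cvg_at_right_filter; exact: cF.
  + by apply: cvg_at_left_filter; exact: cF.
- move=> y; rewrite in_itv/= => /andP[uy _].
  by rewrite derive1E; apply: derive_val; exact: dF (lt_trans u0 uy).
Qed.

Lemma integral_powR_lty (s v : R) : -1 < s ->
  (\int[lebesgue_measure]_(y in `]0%R, v[) (y `^ s)%:E < +oo)%E.
Proof.
move=> s1; have [v0|v0] := leP v 0.
  by rewrite set_itv_ge ?integral_set0// bnd_simp -leNgt.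
(* Starting the denominators at 2 keeps the left endpoint strictly below [v], as [integral_powR_pos]
   demands. *)
pose F k : set R := `[v / k.+2%:R, v]%classic.
have mF k : measurable (F k) by exact: measurable_itv.
have mpow (D : set R) : measurable_fun D (fun y : R => (y `^ s)%:E).
  by apply/measurable_EFinP; apply: measurable_funTS; exact: measurable_powR.
apply: (@le_lt_trans _ _ (\int[lebesgue_measure]_(y in \bigcup_k F k)
    (y `^ s)%:E)%E).
  apply: ge0_subset_integral => //.
  - by apply: bigcup_measurable => k _; exact: mF.
  - exact: mpow.
  - by move=> y _; rewrite lee_fin powR_ge0.
  - move=> y /=; rewrite in_itv/= => /andP[y0 yv].
    exists (Num.truncn (v / y)) => //; rewrite /F/= in_itv/= (ltW yv) andbT.
    rewrite ler_pdivrMr// -ler_pdivrMl// mulrC.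
    apply: (le_trans (ltW (truncnS_gt _))).
    by rewrite ler_nat.
have : (\int[lebesgue_measure]_(y in F k) (y `^ s)%:E @[k --> \oo] -->
    \int[lebesgue_measure]_(y in \bigcup_k F k) (y `^ s)%:E)%E.
  apply: ge0_nondecreasing_set_cvg_integral => //.
  - apply/nondecreasing_seqP => k; apply/subsetPset => y.
    rewrite /F/= !in_itv/= => /andP[ky ->]; rewrite andbT (le_trans _ ky)//.
    by rewrite ler_pM2l// lef_pV2 ?posrE// ler_nat.
  - by move=> k; exact: mpow.
  - by move=> k y _; rewrite lee_fin powR_ge0.
move=> /[dup] Fcvg /cvg_lim <-//.
apply: (@le_lt_trans _ _ (v `^ (s + 1) / (s + 1))%:E); last exact: ltry.
apply: lime_le; first by apply/cvg_ex; eexists; exact: Fcvg.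
apply: nearW => k; apply: integral_powR_pos => //.
rewrite divr_gt0//= ltr_pdivrMr// -[ltLHS]mulr1 ltr_pM2l//.
by rewrite ltr1n.
Qed.

(** At most one factor is singular on each half of the interval: for [x >= 0] the number [2 + x]
    lies in [[2, 4]], and for [x < 0] so does [2 - x]. Bounding that factor by [C] leaves a single
    power on []0, 4[], up to an affine substitution. *)
Lemma integral_jacobi_weight1_lty (a b : R) : -1 < a -> -1 < b ->
  (\int[lebesgue_measure]_x
    ((2 - x) `^ a * (2 + x) `^ b * \1_`](-2), 2[ x)%:E < +oo)%E.
Proof.
move=> a1 b1.
pose C s : R := 2 `^ s + 4 `^ s.
pose h s (y : R) : \bar R := (y `^ s * \1_`]0, 4[ y)%:E.
have h0 s y : (0 <= h s y)%E by rewrite lee_fin mulr_ge0// powR_ge0.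
have mh s : measurable_fun setT (h s).
  apply/measurable_EFinP/measurable_funM; first exact: measurable_powR.
  exact: measurable_indic.
have C0 s : 0 <= C s by rewrite addr_ge0// powR_ge0.
have hoo s : -1 < s -> (\int[lebesgue_measure]_y h s y < +oo)%E.
  move=> s1; have := integral_powR_lty 4 s1; rewrite integral_mkcond.
  congr (_ < _)%E; apply: eq_integral => y _.
  by rewrite patchE /h indicE; case: ifP => _; rewrite ?mulr1 ?mulr0.
have mhl : measurable_fun setT (fun x : R => h a (2 + (-1) * x)).
  exact: measurableT_comp (mh a) (@measurable_affine R (-1) 2).
have mhr : measurable_fun setT (fun x : R => h b (2 + 1 * x)).
  exact: measurableT_comp (mh b) (@measurable_affine R 1 2).
apply: (@le_lt_trans _ _ (\int[lebesgue_measure]_x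
    ((C b)%:E * h a (2 + (-1) * x)%R + (C a)%:E * h b (2 + 1 * x)%R))%E).
  apply: ge0_le_integral => //.
  - by move=> x _; rewrite lee_fin !mulr_ge0// powR_ge0.
  - apply/measurable_EFinP/measurable_funM; last exact: measurable_indic.
    apply: measurable_funM; apply: (measurableT_comp (measurable_powR _)).
      exact: measurable_funB.
    exact: measurable_funD.
  - by apply: emeasurable_funD; exact: measurable_funeM.
  - move=> x _; rewrite mulN1r mul1r -!EFinM -EFinD lee_fin !indicE.
    have -> : (2 - x \in `]0, 4[%classic) = (x \in `](-2), 2[%classic).
      apply/idP/idP; rewrite !inE/= !in_itv/= => /andP[? ?];
      by apply/andP; split; lra.
    have -> : (2 + x \in `]0, 4[%classic) = (x \in `](-2), 2[%classic).
      apply/idP/idP; rewrite !inE/= !in_itv/= => /andP[? ?];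
      by apply/andP; split; lra.
    case: (boolP (_ \in _)) => [|_]; last by rewrite !mulr0 addr0.
    rewrite inE/= in_itv/= !mulr1 => /andP[x1 x2].
    have [x0|x0] := leP 0 x.
      apply: (@le_trans _ _ (C b * (2 - x) `^ a)).
        rewrite mulrC ler_wpM2r ?powR_ge0//; apply: powR_le_endpoints => //.
        by apply/andP; split; lra.
      by rewrite lerDl mulr_ge0// powR_ge0.
    apply: (@le_trans _ _ (C a * (2 + x) `^ b)).
      rewrite ler_wpM2r ?powR_ge0//; apply: powR_le_endpoints => //.
      by apply/andP; split; lra.
    by rewrite lerDr mulr_ge0// powR_ge0.
rewrite ge0_integralD//; last 4 first.
- by move=> x _; rewrite mule_ge0// lee_fin.
- exact: measurable_funeM.
- by move=> x _; rewrite mule_ge0// lee_fin.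
- exact: measurable_funeM.
have fin c s : c != 0 -> -1 < s ->
    (\int[lebesgue_measure]_x h s (2 + c * x)%R < +oo)%E.
  move=> c0 s1; have := hoo s s1; rewrite (ge0_integral_affine 2 c0)//.
  apply: contraTT; rewrite -!leNgt !leye_eq => /eqP ->.
  by rewrite gt0_muley// lte_fin normr_gt0.
rewrite !ge0_integralZl_EFin//.
by rewrite lte_add_pinfty// lte_mul_pinfty// ?lee_fin// fin// oppr_eq0.
Qed.

Lemma ge0_integral_prod_lty n (f : R -> R) :
  measurable_fun setT f -> (forall x, 0 <= f x) ->
  (\int[lebesgue_measure]_x (f x)%:E < +oo)%E ->
  (\int[lebesgue_tuple n]_t (\prod_(j < n) f (tnth t j))%:E < +oo)%E.
Proof.
move=> mf f0 foo.
have mP m : measurable_fun setT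
    (fun t : m.-tuple R => (\prod_(j < m) f (tnth t j))%:E).
  apply/measurable_EFinP; apply: measurable_prod => j _.
  exact: measurableT_comp mf (measurable_tnth j).
elim: n => [|n IHn].
  under eq_integral do rewrite big_ord0.
  by rewrite integral_cst//= diracT mule1 ltry.
rewrite ge0_integral_tupleS//; last by move=> t; rewrite lee_fin prodr_ge0.
under eq_integral => x _.
  rewrite (_ : (\int[_]_t _)%E = ((f x)%:E *
      \int[lebesgue_tuple n]_t (\prod_(j < n) f (tnth t j))%:E)%E); last first.
    rewrite -ge0_integralZl_EFin//; last 2 first.
    - by move=> t _; rewrite lee_fin prodr_ge0.
    - exact: mP.
    apply: eq_integral => t _; rewrite big_ord_recl tnth0 EFinM.
    by under eq_bigr do rewrite tnthS.
  over.
have I0 : (0 <= \int[lebesgue_tuple n]_t (\prod_(j < n) f (tnth t j))%:E)%E.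
  by apply: integral_ge0 => t _; rewrite lee_fin prodr_ge0.
rewrite ge0_integralZr//; last 2 first.
- exact/measurable_EFinP.
- by move=> x _; rewrite lee_fin.
have J0 : (0 <= \int[lebesgue_measure]_x (f x)%:E)%E.
  by apply: integral_ge0 => x _; rewrite lee_fin.
by apply: lte_mul_pinfty => //; rewrite ge0_fin_numE.
Qed.

Lemma normr_vandermonde_le n (x : n.-tuple R) : jacobi_cube x ->
  `|vandermonde x| <= \prod_(k < n) \prod_(l < n | (k < l)%N) 4.
Proof.
move=> xc; rewrite /vandermonde normr_prod; apply: ler_prod => k _.
rewrite normr_ge0 normr_prod/=; apply: ler_prod => l _.
rewrite normr_ge0/=; have := xc k; have := xc l; rewrite !in_itv/=.
by move=> /andP[? ?] /andP[? ?]; rewrite ler_norml; apply/andP; split; lra.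
Qed.

(** On the cube the Vandermonde factor is bounded by a constant, and what remains is a product of
    integrable functions of one variable. *)
Lemma integral_jacobi_density_lty n (beta a b : R) :
  0 < beta -> -1 < a -> -1 < b ->
  (\int[lebesgue_tuple n]_x (jacobi_density beta a b x)%:E < +oo)%E.
Proof.
move=> beta0 a1 b1.
pose M : R := (\prod_(k < n) \prod_(l < n | (k < l)%N) 4) `^ beta.
pose f (x : R) := (2 - x) `^ a * (2 + x) `^ b * \1_`](-2), 2[ x.
have f0 x : 0 <= f x by rewrite !mulr_ge0// powR_ge0.
have mf : measurable_fun setT f.
  apply: measurable_funM; last exact: measurable_indic.
  apply: measurable_funM; apply: (measurableT_comp (measurable_powR _)).
    exact: measurable_funB.
  exact: measurable_funD.
apply: (@le_lt_trans _ _ (\int[lebesgue_tuple n]_x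
    (M%:E * (\prod_(j < n) f (tnth x j))%:E))%E).
  apply: ge0_le_integral => //.
  - by move=> x _; rewrite lee_fin jacobi_density_ge0.
  - apply/measurable_EFinP; exact: measurable_jacobi_density.
  - apply: measurable_funeM; apply/measurable_EFinP.
    apply: measurable_prod => j _.
    exact: measurableT_comp mf (measurable_tnth j).
  - move=> x _; rewrite -EFinM lee_fin /jacobi_density /jacobi_weight -mulrA.
    have [xc|xc] := boolP (x \in @jacobi_cube R n); last first.
      rewrite indicE (negbTE xc) !mulr0 mulr_ge0 ?powR_ge0//.
      by rewrite prodr_ge0.
    rewrite indicE xc mulr1 (eq_bigr (fun j => f (tnth x j))).
      rewrite ler_wpM2r ?prodr_ge0//.
      apply: ge0_ler_powR; rewrite ?nnegrE ?(ltW beta0)//.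
        by rewrite prodr_ge0// => k _; rewrite prodr_ge0.
      by apply: normr_vandermonde_le; rewrite inE in xc.
    move=> j _; rewrite /f indicE mem_set ?mulr1//.
    by rewrite inE in xc; exact: xc.
rewrite ge0_integralZl_EFin ?powR_ge0//; last 2 first.
- by move=> x _; rewrite lee_fin prodr_ge0.
- apply/measurable_EFinP; apply: measurable_prod => j _.
  exact: measurableT_comp mf (measurable_tnth j).
rewrite lte_mul_pinfty ?lee_fin ?powR_ge0//.
by apply: ge0_integral_prod_lty => //; exact: integral_jacobi_weight1_lty.
Qed.

Lemma jacobi_density_gt0 n (beta a b : R) (x : n.-tuple R) :
  jacobi_cube x -> vandermonde x != 0 -> 0 < jacobi_density beta a b x.
Proof.
move=> xc Vx; rewrite /jacobi_density indicE mem_set// mulr1.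
rewrite mulr_gt0 ?powR_gt0 ?normr_gt0// prodr_gt0// => j _.
have := xc j; rewrite in_itv/= => /andP[? ?].
by rewrite mulr_gt0// powR_gt0//; lra.
Qed.

(** Were the integral zero, the density would vanish almost everywhere on a box of positive measure
    on which it is positive. *)
Lemma integral_jacobi_density_gt0 n (beta a b : R) :
  (0 < \int[lebesgue_tuple n]_x (jacobi_density beta a b x)%:E)%E.
Proof.
(* Disjoint consecutive sides inside []0, 1[] force distinct coordinates, hence a nonzero
   Vandermonde determinant. *)
pose A (i : 'I_n) : set R := `]i%:R / n%:R, i.+1%:R / n%:R[%classic.
have mA i : measurable (A i) by exact: measurable_itv.
have mB := measurable_box mA; set B := [set x | _] in mB.
(* The index [i] excludes [n = 0]. That dimension does occur, as the tail of a 1-tuple; there the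
   measure of [B] is an empty product. *)
have n0 (i : 'I_n) : 0 < n%:R :> R by rewrite ltr0n (leq_ltn_trans _ (ltn_ord i)).
have Bpos x : B x -> 0 < jacobi_density beta a b x.
  move=> Bx; apply: jacobi_density_gt0 => [i|].
    have := Bx i; rewrite /A/= !in_itv/= => /andP[ix xi]; apply/andP; split.
      by apply: lt_trans ix; rewrite (@lt_le_trans _ _ 0) ?divr_ge0// oppr_lt0.
    apply: (lt_le_trans xi); rewrite ler_pdivrMr ?(n0 i)//.
    by rewrite (@le_trans _ _ n%:R) ?ler_nat// ler_peMl// ler1n.
  rewrite vandermonde_eq0; apply/negP => /existsP[i /existsP[j /andP[ij /eqP xij]]].
  have lt_tnth (k l : 'I_n) : (k < l)%N -> tnth x k < tnth x l.
    move=> kl; have := Bx k; have := Bx l; rewrite /A/= !in_itv/=.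
    move=> /andP[lx _] /andP[_ xk]; apply: (lt_trans xk); apply: le_lt_trans lx.
    by rewrite ler_pM2r ?invr_gt0 ?(n0 k)// ler_nat.
  move: ij; rewrite neq_ltn => /orP[] /lt_tnth; first by rewrite xij ltxx.
  by rewrite xij ltxx.
have mJ : measurable_fun setT (fun x : n.-tuple R => (jacobi_density beta a b x)%:E).
  apply/measurable_EFinP; exact: measurable_jacobi_density.
apply: (@lt_le_trans _ _
    (\int[lebesgue_tuple n]_(x in B) (jacobi_density beta a b x)%:E)%E); last first.
  by apply: ge0_subset_integral => // x _; rewrite lee_fin jacobi_density_ge0.
rewrite lt0e integral_ge0 ?andbT; last first.
  by move=> x _; rewrite lee_fin jacobi_density_ge0.
apply/eqP => J0.
have : ae_eq (lebesgue_tuple n) B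
    (fun x => (jacobi_density beta a b x)%:E) (cst 0%E).
  apply/ae_eq_integral_abs => //; first exact: measurable_funTS.
  rewrite -[RHS]J0; apply: eq_integral => x _.
  by rewrite gee0_abs// lee_fin jacobi_density_ge0.
move=> [N [mN N0 BN]].
have : (lebesgue_tuple n B <= 0)%E.
  rewrite -N0; apply: le_measure; rewrite ?inE// => x Bx; apply: BN => /=.
  by move=> /(_ Bx)/=[] /eqP; rewrite gt_eqF// Bpos.
apply/negP; rewrite -ltNge lebesgue_tuple_box//.
apply: (big_ind (fun x : \bar R => 0 < x)%E) => //.
  by move=> x y x0 y0; rewrite mule_gt0.
move=> i _; rewrite lebesgue_measure_itv/= lte_fin ltr_pM2r ?invr_gt0 ?(n0 i)//.
by rewrite ltr_nat ltnSn -EFinB lte_fin subr_gt0 ltr_pM2r ?invr_gt0 ?(n0 i)// ltr_nat.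
Qed.

End jacobi_mass.

(** * Density of the determinant *)

Section jacobi_slice.
Context {R : realType} (m : nat) (beta a b : R).
Context (beta_gt0 : 0 < beta).
Implicit Types (x e : R) (t : m.-tuple R).

Local Notation "x ::t t" := [tuple of x :: t] (at level 60).

Lemma det_plus_cons x t : det_plus (x ::t t) = (2 - x) * det_plus t.
Proof.
rewrite /det_plus big_ord_recl tnth0; congr (_ * _).
by apply: eq_bigr => j _; rewrite tnthS.
Qed.

Lemma det_plus_gt0 t : jacobi_cube t -> 0 < det_plus t.
Proof.
move=> tc; apply: prodr_gt0 => j _; have := tc j.
by rewrite in_itv/= subr_gt0 => /andP[].
Qed.

Lemma jacobi_cube_cons x t :
  jacobi_cube (x ::t t) <-> (x \in `](-2), 2[) /\ jacobi_cube t.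
Proof.
split=> [xt|[xc tc] i].
  by split=> [|j]; [have := xt ord0; rewrite tnth0|
    have := xt (lift ord0 j); rewrite tnthS].
by have [j ->|->] := unliftP ord0 i; [rewrite tnthS; exact: tc|rewrite tnth0].
Qed.

Lemma strict_top_cons x t : strict_top ord0 (x ::t t) = [forall j, tnth t j < x].
Proof.
apply/forallP/forallP => h j.
  by have := h (lift ord0 j); rewrite tnthS tnth0.
by apply/implyP; have [k ->|->//] := unliftP ord0 j; rewrite tnthS tnth0.
Qed.

Lemma indic_jacobi_cube_cons x t :
  \1_(@jacobi_cube R m.+1) (x ::t t) =
  \1_`](-2), 2[ x * \1_(@jacobi_cube R m) t :> R.
Proof.
rewrite !indicE -natrM mulnb; congr (_%:R).
suff -> : (x ::t t \in @jacobi_cube R m.+1) =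
  (x \in `](-2), 2[%classic) && (t \in @jacobi_cube R m) by [].
apply/idP/andP; rewrite !inE => /jacobi_cube_cons; tauto.
Qed.

(* The density at [(2 - e / det_plus t) :: t], on the region where the first
   coordinate is the largest, divided by the Jacobian of
   [x |-> (2 - x) * det_plus t]. The inverse of [det_plus t] is written as a
   power because [powR], unlike the inverse, comes with a measurability lemma. *)
Definition jacobi_slice e t : R :=
  let y := 2 - e * det_plus t `^ (-1) ::t t in
  jacobi_density beta a b y * (strict_top ord0 y)%:R * det_plus t `^ (-1).

Lemma jacobi_slice_ge0 e t : 0 <= jacobi_slice e t.
Proof.
apply: mulr_ge0; last exact: powR_ge0.
by apply: mulr_ge0 => //; exact: jacobi_density_ge0.
Qed.

(** For [e <= 0] the first coordinate is at least 2, since [powR] is nonnegative whatever the sign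
    of [det_plus t]. Hence integrals over [e] may run over all of R. *)
Lemma jacobi_slice_eq0 e t : ~ jacobi_cube t \/ e <= 0 -> jacobi_slice e t = 0.
Proof.
move=> h; rewrite /jacobi_slice /jacobi_density indic_jacobi_cube_cons.
case: h => [tc|e0].
  by rewrite (indicE _ (@jacobi_cube R m)) memNset// !(mulr0, mul0r).
rewrite (indicE _ `](-2), 2[%classic) memNset ?(mulr0, mul0r)//= in_itv/= => /andP[_].
apply/negP; rewrite -leNgt lerBrDr gerDl.
by rewrite mulr_le0_ge0 ?powR_ge0.
Qed.

Lemma measurable_jacobi_slice :
  measurable_fun setT (fun z : R * m.-tuple R => jacobi_slice z.1 z.2).
Proof.
have mp : measurable_fun setT (fun z : R * m.-tuple R => det_plus z.2 `^ (-1)).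
  apply: (measurableT_comp (measurable_powR (-1))).
  exact: measurableT_comp (@measurable_det_plus R m) measurable_snd.
have my : measurable_fun setT
    (fun z : R * m.-tuple R => 2 - z.1 * det_plus z.2 `^ (-1) ::t z.2).
  apply: (measurable_cons _ measurable_snd).
  by apply: measurable_funB => //; apply: measurable_funM.
apply: measurable_funM => //; apply: measurable_funM.
  exact: measurableT_comp (@measurable_jacobi_density R _ beta a b) my.
exact: measurableT_comp (@measurable_strict_top_indic R _ ord0) my.
Qed.

(** For [t] in the cube this is the substitution [x = 2 - e / det_plus t], which turns [det_plus] of
    the full tuple into [e]. Outside the cube, where [det_plus t] need not be positive, both
    integrands vanish. *)
Lemma integral_jacobi_slice (g : R -> \bar R) t :
  measurable_fun setT g -> (forall e, (0 <= g e)%E) ->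
  (\int[lebesgue_measure]_x
     ((jacobi_density beta a b (x ::t t) * (strict_top ord0 (x ::t t))%:R)%:E
      * g (det_plus (x ::t t))) =
   \int[lebesgue_measure]_e ((jacobi_slice e t)%:E * g e))%E.
Proof.
move=> mg g0.
have [tc|tc] := pselect (jacobi_cube t); last first.
  rewrite !integral0_eq// => x _.
    by rewrite jacobi_slice_eq0 ?mul0e//; left.
  rewrite /jacobi_density indic_jacobi_cube_cons.
  rewrite (indicE _ (@jacobi_cube R m)) memNset//.
  by rewrite !(mulr0, mul0r) mul0e.
have p0 := det_plus_gt0 tc.
pose c := - (det_plus t)^-1.
have c0 : c != 0 by rewrite oppr_eq0 invr_eq0 gt_eqF.
have mc : measurable_fun setT (fun x : R => x ::t t).
  by apply: measurable_cons => //; exact: measurable_cst.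
pose F x : \bar R :=
  ((jacobi_density beta a b (x ::t t) * (strict_top ord0 (x ::t t))%:R)%:E
   * g (det_plus (x ::t t)))%E.
have F0 x : (0 <= F x)%E.
  by rewrite mule_ge0// lee_fin mulr_ge0 ?jacobi_density_ge0.
have mF : measurable_fun setT F.
  apply: emeasurable_funM.
    apply/measurable_EFinP; apply: measurable_funM.
      exact: measurableT_comp (@measurable_jacobi_density R _ beta a b) mc.
    exact: measurableT_comp (@measurable_strict_top_indic R _ ord0) mc.
  apply: measurableT_comp mg _.
  exact: measurableT_comp (@measurable_det_plus R m.+1) mc.
rewrite -[LHS]/(\int[lebesgue_measure]_x F x)%E.
rewrite (ge0_integral_affine 2 c0 mF F0).
rewrite -ge0_integralZl//; last first.
  exact: measurableT_comp mF (@measurable_affine R c 2).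
apply: eq_integral => e _.
rewrite /F /jacobi_slice powR_inv1 ?ltW//.
have -> : 2 + c * e = 2 - e / det_plus t by rewrite /c mulNr mulrC.
rewrite det_plus_cons subKr divfK ?gt_eqF// muleA -EFinM; congr (_%:E * _)%E.
by rewrite /c normrN normfV gtr0_norm// mulrC.
Qed.

(** This is the density of [det_plus] up to a constant factor. It stays extended-real, as its
    finiteness is obtained only almost everywhere. *)
Definition jacobi_slice_mass e : \bar R :=
  (\int[lebesgue_tuple m]_t (jacobi_slice e t)%:E)%E.

Lemma measurable_jacobi_slice_mass : measurable_fun setT jacobi_slice_mass.
Proof.
apply: (@measurable_fun_fubini_tonelli_F _ _ _ _ _ (lebesgue_tuple m)
  (fun z : R * m.-tuple R => (jacobi_slice z.1 z.2)%:E)).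
- by apply/measurable_EFinP; exact: measurable_jacobi_slice.
- by move=> z; rewrite lee_fin jacobi_slice_ge0.
Qed.

Lemma jacobi_slice_mass_ge0 e : (0 <= jacobi_slice_mass e)%E.
Proof. by apply: integral_ge0 => t _; rewrite lee_fin jacobi_slice_ge0. Qed.

(** Symmetry reduces to the region where the head is the largest; Tonelli's theorem puts the head
    innermost for the substitution, and a second use of it brings [e] outermost. *)
Lemma integral_det_plus (g : R -> \bar R) :
  measurable_fun setT g -> (forall e, (0 <= g e)%E) ->
  (\int[lebesgue_tuple m.+1]_y ((jacobi_density beta a b y)%:E * g (det_plus y))
   = m.+1%:R%:E * \int[lebesgue_measure]_e (jacobi_slice_mass e * g e))%E.
Proof.
move=> mg g0.
rewrite (@ge0_integral_jacobi_density _ m _ _ _ (g \o @det_plus R m.+1))//=.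
- congr (_ * _)%E; rewrite ge0_integral_tupleSr//.
  + under eq_integral do rewrite integral_jacobi_slice//.
    rewrite -(@fubini_tonelli _ _ _ _ _ (@lebesgue_measure R) (lebesgue_tuple m)
      (fun z : R * m.-tuple R => (jacobi_slice z.1 z.2)%:E * g z.1)%E).
    * apply: eq_integral => e _; rewrite /= ge0_integralZr//.
      - apply/measurable_EFinP.
        exact: measurableT_comp measurable_jacobi_slice (measurable_pair1 e).
      - by move=> t _; rewrite lee_fin jacobi_slice_ge0.
    * apply: emeasurable_funM.
        by apply/measurable_EFinP; exact: measurable_jacobi_slice.
      exact: measurableT_comp mg measurable_fst.
    * by move=> z; rewrite mule_ge0// lee_fin jacobi_slice_ge0.
  + apply: emeasurable_funM.
      apply/measurable_EFinP; apply: measurable_funM.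
        exact: measurable_jacobi_density.
      exact: measurable_strict_top_indic.
    exact: measurableT_comp mg (@measurable_det_plus R m.+1).
  + by move=> y; rewrite mule_ge0// lee_fin mulr_ge0 ?jacobi_density_ge0.
- exact: measurableT_comp mg (@measurable_det_plus R m.+1).
- by move=> s y; rewrite det_plus_perm.
Qed.

End jacobi_slice.

(** * Behaviour of the density near 0 *)

Lemma powR_prod (R : realType) (I : Type) (r : seq I) (P : pred I) (f : I -> R)
    (s : R) : (forall i, 0 <= f i) ->
  (\prod_(i <- r | P i) f i) `^ s = \prod_(i <- r | P i) f i `^ s.
Proof.
move=> f0; elim: r => [|i r IHr]; first by rewrite !big_nil powR1.
by rewrite !big_cons; case: ifP => // _; rewrite powRM ?IHr// prodr_ge0.
Qed.

Section jacobi_asymptotics.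
Context {R : realType} (m : nat) (beta a b : R).
Context (beta_gt0 : 0 < beta).
Implicit Types (x e : R) (t : m.-tuple R).

Local Notation "x ::t t" := [tuple of x :: t] (at level 60).

(* The factor by which [jacobi_slice e t / e `^ a] differs from the integrable
   density of parameters [beta, beta - 1, b] in dimension [m]; it is bounded and
   tends to [4 `^ b]. *)
Definition slice_ratio t x : R :=
  (\prod_(j < m) (`|tnth t j - x| / (2 - tnth t j))) `^ beta *
  (2 + x) `^ b * (strict_top ord0 (x ::t t))%:R * \1_`](-2), 2[ x.

Lemma jacobi_weight_cons x t :
  jacobi_weight beta a b (x ::t t) =
  (\prod_(j < m) `|tnth t j - x|) `^ beta * `|vandermonde t| `^ beta *
  ((2 - x) `^ a * (2 + x) `^ b *
   \prod_(j < m) ((2 - tnth t j) `^ a * (2 + tnth t j) `^ b)).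
Proof.
rewrite /jacobi_weight vandermonde_cons normrM powRM// normr_prod.
congr (_ * _); rewrite big_ord_recl tnth0; congr (_ * _).
by apply: eq_bigr => j _; rewrite tnthS.
Qed.

(** Since [e = (2 - x) * det_plus t], the factor [e ^ a] absorbs every power with exponent [a].
    Dividing each [|t_j - x|] by [2 - t_j] inside [slice_ratio] releases [(2 - t_j) ^ beta], and the
    Jacobian lowers that exponent to [beta - 1]. *)
Lemma jacobi_sliceE e t : 0 < e -> jacobi_cube t ->
  jacobi_slice beta a b e t =
  e `^ a * (jacobi_density beta (beta - 1) b t *
            slice_ratio t (2 - e / det_plus t)).
Proof.
move=> e0 tc; have p0 := det_plus_gt0 tc.
rewrite /jacobi_slice powR_inv1 ?ltW// /slice_ratio /jacobi_density.
rewrite indic_jacobi_cube_cons.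
set x := 2 - e / det_plus t; set i1 := \1_`](-2), 2[ x.
set i2 := \1_(@jacobi_cube R m) t; set s := (strict_top _ _)%:R.
rewrite jacobi_weight_cons /jacobi_weight.
have t2 j : 0 < 2 - tnth t j.
  by have := tc j; rewrite in_itv/= subr_gt0 => /andP[].
have e2x : e = (2 - x) * det_plus t by rewrite /x subKr divfK// gt_eqF.
have x2 : 0 <= 2 - x by rewrite /x subKr divr_ge0// ltW.
have -> : e `^ a = (2 - x) `^ a * \prod_(j < m) (2 - tnth t j) `^ a.
  rewrite [in LHS]e2x powRM ?(ltW p0)//; congr (_ * _).
  by rewrite powR_prod// => j; exact: ltW.
have -> : (\prod_(j < m) (`|tnth t j - x| / (2 - tnth t j))) `^ beta =
    (\prod_(j < m) `|tnth t j - x|) `^ beta *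
    (\prod_(j < m) (2 - tnth t j) `^ beta)^-1.
  rewrite !powR_prod//; last by move=> j; rewrite divr_ge0// (ltW (t2 j)).
  rewrite -prodfV -big_split/=; apply: eq_bigr => j _.
  rewrite powRM ?invr_ge0 ?(ltW (t2 j))//; congr (_ * _).
  by rewrite -powR_inv1 ?(ltW (t2 j))// -powRrM mulN1r powRN.
have -> : (det_plus t)^-1 = \prod_(j < m) (2 - tnth t j)^-1.
  by rewrite -prodfV.
rewrite !big_split/=.
have -> : \prod_(j < m) (2 - tnth t j) `^ (beta - 1) =
    \prod_(j < m) (2 - tnth t j) `^ beta * \prod_(j < m) (2 - tnth t j)^-1.
  rewrite -big_split/=; apply: eq_bigr => j _.
  by rewrite powRB ?powRr1 ?(ltW (t2 j))// (gt_eqF (t2 j)) implybT.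
have : \prod_(j < m) (2 - tnth t j) `^ beta != 0.
  by rewrite prodf_seq_neq0; apply/allP => j _ /=; rewrite gt_eqF// powR_gt0.
set P := \prod_(j < m) (2 - tnth t j) `^ beta => P0.
by field.
Qed.

Lemma slice_ratio_ge0 t x : 0 <= slice_ratio t x.
Proof.
rewrite /slice_ratio mulr_ge0// mulr_ge0// mulr_ge0 ?powR_ge0//.
Qed.

(** Where the ratio is nonzero, [t_j < x < 2] makes the product at most 1, and [1 <= x < 2] puts
    [2 + x] between 3 and 4. *)
Lemma slice_ratio_le e t : 0 < e < 1 -> jacobi_cube t ->
  slice_ratio t (2 - e / det_plus t) <= 3 `^ b + 4 `^ b.
Proof.
move=> /andP[e0 e1] tc; have p0 := det_plus_gt0 tc.
set x := 2 - e / det_plus t; rewrite /slice_ratio strict_top_cons.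
have M0 : 0 <= 3 `^ b + 4 `^ b :> R by rewrite addr_ge0 ?powR_ge0.
case: (boolP [forall j, _]) => [/forallP tx|_]; last by rewrite mulr0 mul0r.
have x2 : x < 2 by rewrite /x ltrBlDr ltrDl divr_gt0.
(* If [x < 1], then all factors [2 - tnth t j] exceed 1, so [2 - x <= e < 1]. *)
have x1 : 1 <= x.
  rewrite leNgt; apply/negP => x1.
  have p1 : 1 <= det_plus t.
    rewrite [leLHS](_ : 1 = \prod_(j < m) 1); last by rewrite big1.
    by apply: ler_prod => j _; rewrite ler01/=; have := tx j; lra.
  have : e / det_plus t <= e by rewrite ler_pdivrMr// ler_peMr// ltW.
  by move: x1; rewrite /x; lra.
have -> : \1_`](-2), 2[ x = 1 :> R.
  by rewrite indicE mem_set//= in_itv/=; apply/andP; split; lra.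
rewrite !mulr1; apply: (@le_trans _ _ (1 * (2 + x) `^ b)); last first.
  by rewrite mul1r; apply: powR_le_endpoints => //; apply/andP; split; lra.
have one_beta : 1 `^ beta = 1 :> R by rewrite powR1.
rewrite ler_wpM2r ?powR_ge0// -[leRHS]one_beta.
have r01 : 0 <= \prod_(j < m) (`|tnth t j - x| / (2 - tnth t j)) <= 1.
  apply/andP; split.
    apply: prodr_ge0 => j _; rewrite divr_ge0//.
    by have := tx j; lra.
  apply: prodr_ile1 => j; have := tx j => tjx.
  have t20 : 0 < 2 - tnth t j by lra.
  rewrite divr_ge0 ?(ltW t20)//= ler_pdivrMr// mul1r ltr0_norm; lra.
case/andP : r01 => r0 r1.
by apply: ge0_ler_powR; rewrite ?nnegrE// ltW.
Qed.

Lemma slice_ratio_cvg (u : R^nat) t : jacobi_cube t ->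
  (forall k, 0 < u k) -> u k @[k --> \oo] --> 0 ->
  slice_ratio t (2 - u k / det_plus t) @[k --> \oo] --> 4 `^ b.
Proof.
move=> tc u0 ucvg; have p0 := det_plus_gt0 tc.
have xcvg : 2 - u k / det_plus t @[k --> \oo] --> (2 : R).
  rewrite -[X in _ --> X]subr0 -(mul0r (det_plus t)^-1).
  by apply: cvgB; [exact: cvg_cst|apply: cvgM => //; exact: cvg_cst].
have cvg_pow (r y : R) (v : R^nat) : 0 < y -> v k @[k --> \oo] --> y ->
    v k `^ r @[k --> \oo] --> y `^ r.
  move=> y0; apply: (@continuous_cvg _ _ _ _ _ v (@powR R ^~ r)).
  apply/differentiable_continuous/derivable1_diffP.
  by apply: derivable_powR; rewrite in_itv/= andbT.
have t2 j : 0 < 2 - tnth t j.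
  by have := tc j; rewrite in_itv/= subr_gt0 => /andP[].
have : (\prod_(j < m) (`|tnth t j - (2 - u k / det_plus t)| / (2 - tnth t j)))
    `^ beta * (2 + (2 - u k / det_plus t)) `^ b @[k --> \oo] --> 4 `^ b.
  rewrite -[X in _ --> X]mul1r; apply: cvgM.
    rewrite [X in _ --> X](_ : 1 = 1 `^ beta); last by rewrite powR1.
    apply: cvg_pow => //.
    rewrite [X in _ --> X](_ : 1 = \prod_(j < m) 1); last by rewrite big1.
    apply: (cvg_big (@mul_continuous R)) => j _.
    rewrite [X in _ --> X](_ : 1 = (2 - tnth t j) / (2 - tnth t j)); last first.
      by rewrite divff// gt_eqF.
    apply: cvgMr_tmp.
    rewrite -[X in _ --> X](gtr0_norm (t2 j)) distrC; apply: cvg_norm.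
    by apply: cvgB => //; exact: cvg_cst.
  apply: cvg_pow => //.
  rewrite (_ : 4 = 2 + 2); last by lra.
  by apply: cvgD => //; exact: cvg_cst.
(* As every [t_j] is below 2 and the head tends to 2, both indicator factors are eventually 1. *)
apply: cvg_trans; apply: near_eq_cvg; near=> k.
rewrite /slice_ratio strict_top_cons.
have x2 : 2 - u k / det_plus t < 2 by rewrite ltrBlDr ltrDl divr_gt0.
have -> : [forall j, tnth t j < 2 - u k / det_plus t].
  apply/forallP; near: k; apply: filter_forall => j.
  by apply: (cvgr_gt 2) => //; have := t2 j; rewrite subr_gt0.
rewrite mulr1 indicE mem_set ?mulr1//= in_itv/= x2 andbT.
near: k; apply: (cvgr_gt 2) => //; lra.
Unshelve. all: by end_near. Qed.

End jacobi_asymptotics.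

(** * Dominated convergence as [e] tends to 0 *)

Section jacobi_limit.
Context {R : realType} (m : nat) (beta a b : R).
Context (beta_gt0 : 0 < beta) (b_gtN1 : -1 < b).

(** [fine] sends both infinities to 0, so the division by [e ^ a] can move inside [fine] before the
    mass is known to be finite. *)
Lemma fineMr (x : \bar R) (r : R) : 0 < r -> fine (x * r%:E)%E = fine x * r.
Proof.
move=> r0; case: x => [x//| |].
  by rewrite gt0_mulye ?lte_fin//= mul0r.
by rewrite gt0_mulNye ?lte_fin//= mul0r.
Qed.

Lemma jacobi_slice_mass_cvg :
  fine (jacobi_slice_mass m beta a b e) / e `^ a @[e --> 0^'+] -->
  4 `^ b * fine (\int[lebesgue_tuple m]_t
    (jacobi_density beta (beta - 1) b t)%:E).
Proof.
apply/cvg_at_rightP => u [u_gt0 ucvg].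
have u0 k : 0 < u k by exact: u_gt0.
pose J (t : m.-tuple R) : R := jacobi_density beta (beta - 1) b t.
pose f (k : nat) (t : m.-tuple R) : \bar R :=
  (jacobi_slice beta a b (u k) t / u k `^ a)%:E.
have mJ : measurable_fun setT (fun t : m.-tuple R => (J t)%:E).
  by apply/measurable_EFinP; exact: measurable_jacobi_density.
have J0 (t : m.-tuple R) : 0 <= J t by exact: jacobi_density_ge0.
have Joo : (\int[lebesgue_tuple m]_t (J t)%:E < +oo)%E.
  by apply: integral_jacobi_density_lty => //; rewrite -subr_gt0 opprK subrK.
have Jge0 : (0 <= \int[lebesgue_tuple m]_t (J t)%:E)%E.
  by apply: integral_ge0 => t _; rewrite lee_fin.
have JE : (\int[lebesgue_tuple m]_t (J t)%:E =
    (fine (\int[lebesgue_tuple m]_t (J t)%:E))%:E)%E.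
  by rewrite fineK// ge0_fin_numE.
(* Outside the cube [J t] is 0; replacing the ratio by 0 there makes its bound available for every
   [t]. *)
have fE k t : f k t = (J t * if pselect (jacobi_cube t) then
    slice_ratio beta b t (2 - u k / det_plus t) else 0)%:E.
  rewrite /f; case: pselect => tc.
    by rewrite jacobi_sliceE// mulrAC divff ?mul1r// gt_eqF// powR_gt0.
  by rewrite jacobi_slice_eq0 ?mul0r ?mulr0//; left.
have Jcube t : ~ jacobi_cube t -> J t = 0.
  by move=> tc; rewrite /J /jacobi_density indicE memNset// mulr0.
have mf k : measurable_fun setT (f k).
  apply/measurable_EFinP; apply: measurable_funM => //.
  exact: measurableT_comp (@measurable_jacobi_slice R m beta a b)
    (measurable_pair1 (u k)).
have massE k : fine (jacobi_slice_mass m beta a b (u k)) / u k `^ a =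
    fine (\int[lebesgue_tuple m]_t f k t).
  rewrite -fineMr ?invr_gt0 ?powR_gt0//.
  congr fine; rewrite /jacobi_slice_mass -ge0_integralZr//.
  - by apply/measurable_EFinP; exact: measurableT_comp
      (@measurable_jacobi_slice R m beta a b) (measurable_pair1 (u k)).
  - by move=> t _; rewrite lee_fin jacobi_slice_ge0.
  - by rewrite lee_fin invr_ge0 powR_ge0.
rewrite (eq_cvg _ _ massE); apply: fine_cvg.
have -> : ((4 `^ b * fine (\int[lebesgue_tuple m]_t (J t)%:E))%:E =
    \int[lebesgue_tuple m]_t (4 `^ b * J t)%:E)%E.
  rewrite EFinM -JE -ge0_integralZl_EFin ?powR_ge0// => t _.
  by rewrite lee_fin.
(* The domination holds only for [u k < 1], so the sequence is shifted past the index [N]. *)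
have [N _ uN] : \forall k \near \oo, u k < 1.
  by apply: (cvgr_lt 0) => //; exact: ltr01.
rewrite -(cvg_shiftn N).
have [] := @dominated_convergence _ _ _ (lebesgue_tuple m) setT measurableT
  (fun k => f (k + N)%N) (fun t => (4 `^ b * J t)%:E)
  (fun t => ((3 `^ b + 4 `^ b) * J t)%:E) => //.
- by apply/measurable_EFinP; apply: measurable_funM => //; apply/measurable_EFinP.
- apply: aeW => t _.
  rewrite (cvg_shiftn N (fun k => f k t)).
  rewrite (eq_cvg _ _ (fun k => fE k t)) mulrC.
  case: pselect => tc; last by rewrite /= Jcube// !mul0r; exact: cvg_cst.
  apply: cvg_EFin; first exact: nearW.
  by apply: cvgM; [exact: cvg_cst|exact: slice_ratio_cvg].
- apply/integrableP; split.
    by apply/measurable_EFinP; apply: measurable_funM => //; apply/measurable_EFinP.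
  under eq_integral => t _.
    rewrite gee0_abs; last by rewrite lee_fin mulr_ge0// addr_ge0 ?powR_ge0.
    rewrite EFinM.
    over.
  rewrite ge0_integralZl_EFin ?addr_ge0 ?powR_ge0//.
    by rewrite JE -EFinM ltry.
  by move=> t _; rewrite lee_fin.
- apply: aeW => t k _; rewrite fE gee0_abs; last first.
    by rewrite lee_fin mulr_ge0//; case: pselect => // ?; exact: slice_ratio_ge0.
  rewrite lee_fin mulrC ler_wpM2r//; case: pselect => tc.
    apply: slice_ratio_le => //; rewrite u0/=; apply: uN.
    exact: leq_addl.
  by rewrite addr_ge0 ?powR_ge0.
Qed.

End jacobi_limit.

(** * The density of the determinant and its equivalent at 0 *)

Theorem corollary5p1 (R : realType) (n : nat) (beta a b : R)
    (hn : (1 <= n)%N) (hbeta : 0 < beta) (ha : -1 < a) (hb : -1 < b) :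
  exists c : R, 0 < c /\
    forall (d : measure_display) (Omega : measurableType d)
      (P : probability Omega R) (X : {RV P >-> n.-tuple R}),
      jacobi_distributed beta a b X ->
      exists h : R -> R,
        is_density_pos (pushforward P (@det_plus R n \o X)) h /\
        h ~_(0^'+) (fun e => c * e `^ a).
Proof.
case: n hn => [//|m] _.
(* This serves twice: for the normalization in dimension [m.+1], and for the limiting weight in
   dimension [m], whose exponent [beta - 1] exceeds -1. *)
have fine_mass_gt0 k beta' a' b' : 0 < beta' -> -1 < a' -> -1 < b' ->
    0 < fine (\int[lebesgue_tuple k]_t (jacobi_density beta' a' b' t)%:E) :> R.
  move=> beta'0 a'1 b'1; rewrite fine_gt0// integral_jacobi_density_gt0/=.
  exact: integral_jacobi_density_lty.
have ZE : jacobi_mass m.+1 beta a b =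
    (\int[lebesgue_tuple m.+1]_y (jacobi_density beta a b y)%:E)%E.
  rewrite /jacobi_mass -[@jacobi_cube R m.+1]setTI integral_jacobi_density.
  by apply: eq_integral => y _; rewrite indicT mule1.
set z := fine (jacobi_mass m.+1 beta a b).
have z0 : 0 < z by rewrite /z ZE fine_mass_gt0.
set J := fine (\int[lebesgue_tuple m]_t (jacobi_density beta (beta - 1) b t)%:E).
have J0 : 0 < J by apply: fine_mass_gt0 => //; rewrite -subr_gt0 opprK subrK.
pose M := jacobi_slice_mass m beta a b.
have mM : measurable_fun setT M by exact: measurable_jacobi_slice_mass.
have M0 e : (0 <= M e)%E by exact: jacobi_slice_mass_ge0.
(* One factor normalizes the law; the other counts the possible positions of the largest
   coordinate. *)
pose k : R := z^-1 * m.+1%:R.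
have k0 : 0 < k by rewrite mulr_gt0 ?invr_gt0.
have L0 : 0 < 4 `^ b * J by rewrite mulr_gt0 ?powR_gt0.
exists (k * (4 `^ b * J)); split; first exact: mulr_gt0.
move=> d Omega P X HX.
have lawE B : measurable B -> pushforward P (@det_plus R m.+1 \o X) B =
    (k%:E * \int[lebesgue_measure]_e (M e * (\1_B e)%:E))%E.
  move=> mB; have mdB : measurable (@det_plus R m.+1 @^-1` B).
    by rewrite -[X in measurable X]setTI; exact: measurable_det_plus.
  rewrite -[LHS]/(distribution P X (@det_plus R m.+1 @^-1` B)) HX//.
  rewrite /jacobi_law -/z integral_jacobi_density.
  rewrite EFinM -muleA -(integral_det_plus m a b hbeta)//.
  by apply/measurable_EFinP; exact: measurable_indic.
(* The total mass 1 of the law equals [k] times the integral of [M], which is therefore finite. *)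
have intM : lebesgue_measure.-integrable setT M.
  apply/integrableP; split => //.
  under eq_integral do rewrite gee0_abs//.
  have kM : (1 = k%:E * \int[lebesgue_measure]_e M e)%E.
    have := lawE setT measurableT.
    rewrite /pushforward preimage_setT probability_setT => ->.
    congr (_ * _)%E; apply: eq_integral => e _.
    by rewrite indicE in_setT mule1.
  rewrite ltey; apply/eqP => Moo; move: kM.
  by rewrite Moo gt0_muley ?lte_fin.
(* [fine] makes the density real-valued; it alters [M] only on the null set where [M] is
   infinite. *)
exists (fun e => k * fine (M e)); split; last first.
  apply/eqaddoP => eps eps0; near=> e.
  have e0 : 0 < e by near: e; exact: nbhs_right_gt.
  have ea0 : 0 < e `^ a by exact: powR_gt0.
  (* Factoring out [k * e ^ a] reduces the equivalence to the limit in [jacobi_slice_mass_cvg], with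
     tolerance [eps * (4 ^ b * J)]. *)
  have -> : ((fun e => k * fine (M e)) - (fun e => k * (4 `^ b * J) * e `^ a)) e =
      k * e `^ a * (fine (M e) / e `^ a - 4 `^ b * J).
    rewrite -[LHS]/(k * fine (M e) - k * (4 `^ b * J) * e `^ a).
    by field; rewrite gt_eqF.
  have kea0 : 0 < k * e `^ a by exact: mulr_gt0.
  rewrite normrM (gtr0_norm kea0) (@gtr0_norm _ (k * (4 `^ b * J) * e `^ a)).
    2: by apply: mulr_gt0 => //; exact: mulr_gt0.
  rewrite [leRHS](_ : _ = k * e `^ a * (eps * (4 `^ b * J))); last by ring.
  rewrite ler_pM2l// distrC; near: e.
  have epsJ : 0 < eps * (4 `^ b * J) by exact: mulr_gt0.
  have := @jacobi_slice_mass_cvg R m beta a b hbeta hb.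
  by move=> /cvgrPdist_le/(_ _ epsJ).
split.
- apply: measurable_funTS; apply: measurable_funM => //.
  exact: measurableT_comp.
- by move=> e _; rewrite mulr_ge0 ?fine_ge0// ltW.
move=> B mB; rewrite lawE//.
have mBp : measurable (B `&` `]0%R, +oo[%classic) by exact: measurableI.
(* Since [M] vanishes for [e <= 0], restricting to the positive half-line loses no mass. *)
have -> : (\int[lebesgue_measure]_e (M e * (\1_B e)%:E) =
    \int[lebesgue_measure]_(e in B `&` `]0%R, +oo[) M e)%E.
  rewrite [RHS]integral_mkcond; apply: eq_integral => e _.
  rewrite patchE in_setI indicE.
  have [e0|e0] := ltP 0 e.
    rewrite (mem_set (_ : `]0, +oo[%classic e)) ?andbT; last first.
      by rewrite /= in_itv/= e0.
    by case: ifP => _; rewrite ?mule1 ?mule0.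
  have -> : M e = 0%E.
    by apply: integral0_eq => t _; rewrite jacobi_slice_eq0//; right.
  by rewrite mul0e if_same.
rewrite -ge0_integralZl_EFin ?(ltW k0)//; last exact: measurable_funTS.
apply: ge0_ae_eq_integral => //.
- by apply: measurable_funTS; exact: measurable_funeM.
- apply: measurable_funTS; apply/measurable_EFinP.
  by apply: measurable_funM => //; exact: measurableT_comp.
- by move=> e _; rewrite mule_ge0// lee_fin ltW.
- by move=> e _; rewrite lee_fin mulr_ge0 ?fine_ge0// ltW.
have := integrable_ae measurableT intM; apply: filterS => e Mfin _.
by rewrite /= -[in LHS](fineK (Mfin I)).
Unshelve. all: by end_near. Qed.
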